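(* Consider the Hamiltonians $H^{L},H^{ON},H^{PH},H^{BP}$ and the neighborhood $\Gamma$ of $\partial\Omega$ and the field $n$ described in the context, and, for a Hamiltonian $H$, the following properties (holding for some neighborhood $\Gamma$ of $\partial\Omega$; $x\in\Gamma$ means $x\in\Gamma\cap\overline\Omega$). (H3) For all $0<R<+\infty$ there exists a function $m_R$ with $m_R(t)\to0$ as $t\to0$ such that $|H(x,u,p)-H(x,u,q)|\le m_R(|p-q|)$ for all $x\in\Gamma$, $-R\le u\le R$, $p,q\in\mathbb{R}^2$. (H4) For all $0<R<+\infty$ there exists $C_R>0$ such that for all $(x,u,p)\in\Gamma\times[-R,R]\times\mathbb{R}^2$ and $\lambda\in\mathbb{R}$, $H(x,u,p+\lambda n(x))\le 0$ implies $\lambda\le C_R(1+|p|)$. (H5) For all $R_1,R_2\in\mathbb{R}^+$, $H(x,u,p-\lambda n(x))\to+\infty$ as $\lambda\to+\infty$, uniformly for $(x,u,p)\in\Gamma\times[-R_1,R_2]\times B(0,R_2)$. Then: (i) $H^{L}$, $H^{PH}$ and $H^{BP}$ satisfy (H3), (H4) and (H5). (ii) $H^{ON}$ satisfies (H3).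
   Context: Let $\Omega\subset\mathbb{R}^2$ be a bounded open set with $\partial\Omega$ of class $W^{2,\infty}$, and $f>0$ a constant. For $x\in\mathbb{R}^2$, $p\in\mathbb{R}^2$ put $$Q(x)=\frac{f}{\sqrt{f^2+|x|^2}},\qquad W(x,p)=\frac{f^2|p|^2+(p\cdot x)^2}{Q(x)^2}.$$ Constants: for the Oren-Nayar model, $\sigma\in[0,\pi/2)$, $A=1-0.5\,\sigma^2(\sigma^2+0.33)^{-1}$, $B=0.45\,\sigma^2(\sigma^2+0.09)^{-1}$; for the Phong and Blinn-Phong models, $k_A,k_D,k_S\ge 0$ with $k_A+k_D+k_S=1$ and $k_D>0$; $\alpha\ge1$ is an integer; $c\ge 1$ is a real number. Define on $[0,+\infty)$ $$F_L(r)=\sqrt{r+1},\qquad F_{ON}(r)=\frac{r+1}{A\sqrt{r+1}+Br},\qquad F_{BP}(r)=\frac{(r+1)^{c/2}}{k_D(r+1)^{\frac{c-1}{2}}+k_S},$$ $$F_{PH}(r)=\begin{cases}\dfrac{\sqrt{r+1}}{k_D}& r\ge 1,\\[2mm] \dfrac{(r+1)^{\alpha+1/2}}{k_D(r+1)^{\alpha}+k_S(r+1)^{1/2}(1-r)^{\alpha}}& 0\le r<1.\end{cases}$$ Let $I,I_A:\overline\Omega\to\mathbb{R}$ be given functions (image intensity and ambient light component). For $M\in\{L,ON,PH,BP\}$ the Hamiltonian is $$H^{M}(x,r,p)=-e^{-2r}+\mathcal{I}(x)\,f^2\,F_M(W(x,p)),\qquad x\in\overline\Omega,\ r\in\mathbb{R},\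 p\in\mathbb{R}^2,$$ where $\mathcal{I}=I$ if $M\in\{L,ON\}$ and $\mathcal{I}=I-k_AI_A$ if $M\in\{PH,BP\}$. Standing assumption: $\mathcal{I}$ is Lipschitz continuous in $\overline\Omega$, and there exist $\delta>0$ and a neighborhood $\Gamma$ of $\partial\Omega$ such that $\mathcal{I}(x)\ge\delta>0$ for $x\in\Gamma$ (i.e. for $x\in\Gamma\cap\overline\Omega$). The field $n$ is the outward unit normal to $\partial\Omega$, extended to a unit vector field near $\partial\Omega$ inside $\overline\Omega$ by $n(x)=-\nabla d(x)$, $d$ being the distance to $\partial\Omega$ ($\Gamma$ is taken small enough for this to make sense). $B(0,R_2)$ is the ball of radius $R_2$ centred at $0$ in $\mathbb{R}^2$. *)

(* Defs.v *)
From HB Require Import structures.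
From mathcomp Require Import all_boot all_order all_algebra.
From mathcomp Require Import all_classical all_reals all_analysis.

Set Implicit Arguments.
Unset Strict Implicit.
Unset Printing Implicit Defensive.

Import Order.TTheory GRing.Theory Num.Theory.
Import numFieldNormedType.Exports.

Local Open Scope classical_set_scope.
Local Open Scope ring_scope.

(* The library norm of 'rV[R]_2 is the sup norm: it is used only for notions    *)
(* that do not depend on the choice of an equivalent norm (open, closure,      *)
(* bounded, Lipschitz, differentiable); lengths and distances use [enorm].     *)
Definition dot (R : realType) (u v : 'rV[R]_2) : R := \sum_(i < 2) u 0 i * v 0 i.

Definition enorm (R : realType) (u : 'rV[R]_2) : R := Num.sqrt (dot u u).

Definition bdry (T : topologicalType) (A : set T) : set T := closure A `\` A°.

Definition dist_bdry (R : realType) (Omega : set 'rV[R]_2) (x : 'rV[R]_2) : R :=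
  inf [set enorm (x - y) | y in bdry Omega].

Definition grad (R : realType) (g : 'rV[R]_2 -> R) (x : 'rV[R]_2) : 'rV[R]_2 :=
  \row_i 'D_(delta_mx 0 i) g x.

Definition test_function (R : realType) (a b : R) (psi : R -> R) : Prop :=
  (forall (k : nat) (x : R), derivable (derive1n k psi) x 1) /\
  exists a' b' : R, [/\ a < a', b' < b &
    forall x : R, ~ (a' <= x <= b') -> psi x = 0].

Definition Linfty (R : realType) (a b : R) (u : R -> R) : Prop :=
  measurable_fun `]a, b[ u /\
  finite_norm (@lebesgue_measure R) +oo%E (u \_ `]a, b[).

Definition weak_derivative (R : realType) (a b : R) (u v : R -> R) : Prop :=
  forall psi : R -> R, test_function a b psi ->
    (\int[@lebesgue_measure R]_(x in `]a, b[) (u x * derive1 psi x)%:E =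
     - \int[@lebesgue_measure R]_(x in `]a, b[) (v x * psi x)%:E)%E.

Definition W2infty (R : realType) (a b : R) (u : R -> R) : Prop :=
  exists u1 u2 : R -> R,
    [/\ Linfty a b u, Linfty a b u1, Linfty a b u2,
        weak_derivative a b u u1 & weak_derivative a b u1 u2].

(* In the orthonormal frame (t, e) centred at x0, Omega is locally the region   *)
(* strictly above the graph of phi, phi being the continuous representative of *)
(* a W^{2,oo} function (hence differentiable).                                 *)
Definition W2infty_chart (R : realType) (Omega : set 'rV[R]_2)
    (x0 t e : 'rV[R]_2) (phi : R -> R) : Prop :=
  [/\ dot t t = 1, dot e e = 1, dot t e = 0 &
   exists r h : R, [/\ 0 < r, 0 < h,
     {in `]- r, r[, continuous phi}, W2infty (- r) r phi &
     forall s z : R, - r < s < r -> - h < z < h ->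
       (Omega (x0 + s *: t + z *: e) <-> phi s < z)]].

Definition W2infty_boundary (R : realType) (Omega : set 'rV[R]_2) : Prop :=
  forall x0 : 'rV[R]_2, bdry Omega x0 ->
    exists (t e : 'rV[R]_2) (phi : R -> R), W2infty_chart Omega x0 t e phi.

Definition outward_unit_normal (R : realType) (Omega : set 'rV[R]_2)
    (x0 nu : 'rV[R]_2) : Prop :=
  exists (t e : 'rV[R]_2) (phi : R -> R), W2infty_chart Omega x0 t e phi /\
    nu = (Num.sqrt (1 + derive1 phi 0 ^+ 2))^-1 *: (derive1 phi 0 *: t - e).

(* The field n is only constrained on Gamma `&` closure Omega; differentiability *)
(* of the distance says that Gamma is small enough for n = - grad d to make    *)
(* sense. On bdry Omega the distance is not differentiable, whence the two     *)
(* clauses.                                                                    *)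
Definition normal_field (R : realType) (Omega Gamma : set 'rV[R]_2)
    (n : 'rV[R]_2 -> 'rV[R]_2) : Prop :=
  (forall x, bdry Omega x -> outward_unit_normal Omega x (n x)) /\
  (forall x, Gamma x -> Omega x ->
     differentiable (dist_bdry Omega) x /\ n x = - grad (dist_bdry Omega) x).

Definition Qfun (R : realType) (f : R) (x : 'rV[R]_2) : R :=
  f / Num.sqrt (f ^+ 2 + enorm x ^+ 2).

Definition Wfun (R : realType) (f : R) (x p : 'rV[R]_2) : R :=
  (f ^+ 2 * enorm p ^+ 2 + dot p x ^+ 2) / Qfun f x ^+ 2.

Inductive model := Lambertian | OrenNayar | Phong | BlinnPhong.

Definition ON_A (R : realType) (sigma : R) : R :=
  1 - 1 / 2 * sigma ^+ 2 / (sigma ^+ 2 + 33 / 100).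

Definition ON_B (R : realType) (sigma : R) : R :=
  45 / 100 * sigma ^+ 2 / (sigma ^+ 2 + 9 / 100).

Definition F_L (R : realType) (r : R) : R := Num.sqrt (r + 1).

Definition F_ON (R : realType) (sigma r : R) : R :=
  (r + 1) / (ON_A sigma * Num.sqrt (r + 1) + ON_B sigma * r).

Definition F_BP (R : realType) (kD kS c r : R) : R :=
  (r + 1) `^ (c / 2) / (kD * (r + 1) `^ ((c - 1) / 2) + kS).

Definition F_PH (R : realType) (kD kS : R) (alpha : nat) (r : R) : R :=
  if 1 <= r then Num.sqrt (r + 1) / kD
  else (r + 1) `^ (alpha%:R + 1 / 2) /
       (kD * (r + 1) ^+ alpha + kS * (r + 1) `^ (1 / 2) * (1 - r) ^+ alpha).

Definition Ffun (R : realType) (sigma kD kS : R) (alpha : nat) (c : R)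
    (M : model) : R -> R :=
  match M with
  | Lambertian => @F_L R
  | OrenNayar => F_ON sigma
  | Phong => F_PH kD kS alpha
  | BlinnPhong => F_BP kD kS c
  end.

Definition effective_intensity (R : realType) (kA : R) (I IA : 'rV[R]_2 -> R)
    (M : model) (x : 'rV[R]_2) : R :=
  match M with
  | Lambertian | OrenNayar => I x
  | Phong | BlinnPhong => I x - kA * IA x
  end.

Definition hamiltonian (R : realType) (f sigma kA kD kS : R) (alpha : nat)
    (c : R) (I IA : 'rV[R]_2 -> R) (M : model)
    (x : 'rV[R]_2) (r : R) (p : 'rV[R]_2) : R :=
  - expR (- 2 * r) + effective_intensity kA I IA M x * f ^+ 2 *
    Ffun sigma kD kS alpha c M (Wfun f x p).

Definition intensity_assumption (R : realType) (Omega Gamma : set 'rV[R]_2)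
    (J : 'rV[R]_2 -> R) : Prop :=
  [lipschitz J x | x in closure Omega] /\
  exists2 delta : R, 0 < delta &
    forall x, Gamma x -> closure Omega x -> delta <= J x.

(* In H3-H5 the set D stands for Gamma `&` closure Omega. *)
Definition H3 (R : realType) (D : set 'rV[R]_2)
    (H : 'rV[R]_2 -> R -> 'rV[R]_2 -> R) : Prop :=
  forall rho : R, 0 < rho ->
    exists m : R -> R, m t @[t --> 0^'+] --> (0 : R) /\
      forall (x : 'rV[R]_2) (u : R) (p q : 'rV[R]_2),
        D x -> - rho <= u <= rho -> `|H x u p - H x u q| <= m (enorm (p - q)).

Definition H4 (R : realType) (D : set 'rV[R]_2) (n : 'rV[R]_2 -> 'rV[R]_2)
    (H : 'rV[R]_2 -> R -> 'rV[R]_2 -> R) : Prop :=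
  forall rho : R, 0 < rho ->
    exists2 C : R, 0 < C &
      forall (x : 'rV[R]_2) (u : R) (p : 'rV[R]_2) (lambda : R),
        D x -> - rho <= u <= rho ->
        H x u (p + lambda *: n x) <= 0 -> lambda <= C * (1 + enorm p).

Definition H5 (R : realType) (D : set 'rV[R]_2) (n : 'rV[R]_2 -> 'rV[R]_2)
    (H : 'rV[R]_2 -> R -> 'rV[R]_2 -> R) : Prop :=
  forall R1 R2 : R, 0 < R1 -> 0 < R2 ->
    forall K : R, \forall lambda \near +oo,
      forall (x : 'rV[R]_2) (u : R) (p : 'rV[R]_2),
        D x -> - R1 <= u <= R2 -> enorm p < R2 ->
        K <= H x u (p - lambda *: n x).

(* Main.v *)
Require Import Defs.
From HB Require Import structures.
From mathcomp Require Import all_boot all_order all_algebra.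
From mathcomp Require Import all_classical all_reals all_analysis.
From mathcomp Require Import ring lra.
Import Order.TTheory GRing.Theory Num.Theory.
Import numFieldNormedType.Exports.
Local Open Scope classical_set_scope.
Local Open Scope ring_scope.

(** With w = sqrt (W + 1) >= 1, each of the four reflectance functions takes the
    form F (W) = w / (k + l w psi (w)), where k > 0, l >= 0 and psi >= 0; see
    [Ffun_profile].  Both halves of the statement come from this form.

    Continuity in p.  A difference of two values of w / (k + l w psi (w)) has
    numerator k (w - v) + l w v (psi (v) - psi (w)) and denominator at least
    k ^ 2, so F is a Lipschitz function of w as soon as w v (psi (v) - psi (w))
    is at most a multiple of w - v ([profile_lipschitz]).  This is an elementary
    estimate for each model: Bernoulli's inequality for Blinn-Phong, the
    telescoping of a difference of powers for Phong.  In turn w is the length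
    of a vector that depends linearly on p up to the term |p|, hence it is
    Lipschitz in p, uniformly for x in a bounded set ([sqrt_Wfun_lipschitz]).  A
    Lipschitz intensity being bounded on the closure of Omega, H is Lipschitz
    in p and the modulus in (H3) can be taken linear.

    Growth in the normal direction.  For every model but Oren-Nayar one has
    w psi (w) <= 1, so that F (W) >= w / (k + l) ([profile_ge]); together with
    W >= f ^ 2 |p| ^ 2 and the lower bound delta on the intensity this gives
    H (x, u, p) >= K |p| - exp (- 2 u) for some K > 0
    ([hamiltonian_coercive]).  (H4) and (H5) then only require |n| >= 1, since
    |p + lambda n| >= |lambda| - |p|.  (In the Oren-Nayar model F is bounded
    when B > 0, and the argument breaks down.)

    Length of n.  On the boundary n is a unit vector by its explicit formula.
    At an interior point x the distance d to the boundary is attained at some y,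
    and d decreases at unit rate when x moves towards y; so the derivative of d
    in that unit direction is at most -1 and |grad d| >= 1 by Cauchy-Schwarz
    ([enorm_grad_dist_ge1]). *)

(** * Euclidean geometry of the plane *)

Lemma dotE {R : realType} (u v : 'rV[R]_2) :
  dot u v = u 0 0 * v 0 0 + u 0 1 * v 0 1.
Proof.
rewrite /dot big_ord_recl big_ord1.
by congr (_ + _ * _); congr fun_of_matrix; apply: val_inj.
Qed.

Lemma enorm_ge0 {R : realType} (u : 'rV[R]_2) : 0 <= enorm u.
Proof. exact: sqrtr_ge0. Qed.

Lemma enorm_sqr {R : realType} (u : 'rV[R]_2) : enorm u ^+ 2 = dot u u.
Proof. by rewrite sqr_sqrtr// dotE -!expr2 addr_ge0 ?sqr_ge0. Qed.

Lemma enormZ {R : realType} (a : R) (u : 'rV[R]_2) :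
  enorm (a *: u) = `|a| * enorm u.
Proof.
rewrite /enorm (_ : dot (a *: u) (a *: u) = a ^+ 2 * dot u u).
  by rewrite sqrtrM ?sqr_ge0// sqrtr_sqr.
by rewrite !dotE !mxE; ring.
Qed.

Lemma enormN {R : realType} (u : 'rV[R]_2) : enorm (- u) = enorm u.
Proof. by rewrite -scaleN1r enormZ normrN1 mul1r. Qed.

Lemma Cauchy_Schwarz {R : realType} (u v : 'rV[R]_2) :
  `|dot u v| <= enorm u * enorm v.
Proof.
rewrite -ler_sqr ?nnegrE ?mulr_ge0 ?enorm_ge0//.
rewrite real_normK ?num_real// exprMn !enorm_sqr !dotE.
have := sqr_ge0 (u 0 0 * v 0 1 - u 0 1 * v 0 0); lra.
Qed.

Lemma ler_enormD {R : realType} (u v : 'rV[R]_2) :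
  enorm (u + v) <= enorm u + enorm v.
Proof.
rewrite -ler_sqr ?nnegrE ?addr_ge0 ?enorm_ge0// sqrrD !enorm_sqr.
have := le_trans (ler_norm _) (Cauchy_Schwarz u v).
rewrite !dotE !mxE; lra.
Qed.

Lemma ler_dist_enorm {R : realType} (u v : 'rV[R]_2) :
  `|enorm u - enorm v| <= enorm (u - v).
Proof.
have := ler_enormD (u - v) v; have := ler_enormD (v - u) u.
rewrite !subrK -(opprB u v) enormN => ? ?.
by rewrite ler_norml; apply/andP; split; lra.
Qed.

Lemma enorm_eq0 {R : realType} (u : 'rV[R]_2) : (enorm u == 0) = (u == 0).
Proof.
apply/eqP/eqP => [u0|->]; last first.
  by rewrite -(scale0r (0 : 'rV[R]_2)) enormZ normr0 mul0r.
have : dot u u = 0 by rewrite -enorm_sqr u0 expr0n.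
rewrite dotE => /eqP; rewrite -!expr2 paddr_eq0 ?sqr_ge0// !sqrf_eq0.
move=> /andP[/eqP u00 /eqP u01]; apply/rowP => i; rewrite mxE.
case: i => -[|[|//]] i2; [rewrite -[RHS]u00|rewrite -[RHS]u01];
  by congr fun_of_matrix; apply: val_inj.
Qed.

(** The norm on the right is the sup norm; the comparison transfers boundedness
    to Euclidean lengths. *)
Lemma enorm_le_norm {R : realType} (u : 'rV[R]_2) : enorm u <= 2 * `|u|.
Proof.
rewrite -ler_sqr ?nnegrE ?mulr_ge0 ?enorm_ge0// enorm_sqr dotE exprMn.
have le_coord i : u 0 i ^+ 2 <= `|u| ^+ 2.
  rewrite -real_normK ?num_real// ler_sqr ?nnegrE//.
  rewrite [leRHS]/Num.norm /= mx_normrE.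
  exact: (le_bigmax_cond _ (fun ij => `|u ij.1 ij.2|) (j := (0, i))).
have := le_coord 0; have := le_coord 1; have := sqr_ge0 `|u|; lra.
Qed.

Lemma continuous_enorm {R : realType} : continuous (@enorm R).
Proof.
have cdot : continuous (fun u : 'rV[R]_2 => dot u u).
  have -> : (fun u : 'rV[R]_2 => dot u u) =
      (fun u : 'rV[R]_2 => u 0 0 * u 0 0 + u 0 1 * u 0 1).
    by apply/funext => u; exact: dotE.
  have cu i j : continuous (fun u : 'rV[R]_2 => u i j).
    exact: coord_continuous.
  by move=> u; exact: (cvgD (cvgM (cu 0 0 u) (cu 0 0 u))
    (cvgM (cu 0 1 u) (cu 0 1 u))).
move=> u; apply: (@continuous_comp _ _ _ (fun u : 'rV[R]_2 => dot u u)).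
  exact: cdot.
exact: sqrt_continuous.
Qed.

(** * The distance to the boundary and its gradient *)

Lemma bounded_closure {R : realType} {V : normedModType R} (A : set V) :
  bounded_set A -> bounded_set (closure A).
Proof.
move=> [M [Mreal AM]]; exists M; split=> // N MN.
have clN : closed [set x : V | `|x| <= N].
  apply: (@closed_comp _ _ (fun x : V => `|x|) [set t : R | t <= N]).
    by move=> x _; exact: norm_continuous.
  exact: closed_le.
move=> x /= Ax; have /closure_id := clN => clNE.
have : closure [set x : V | `|x| <= N] x by apply: closureS Ax; exact: AM.
by rewrite -clNE.
Qed.

Lemma compact_bdry {R : realType} n (A : set 'rV[R]_n) :
  bounded_set A -> compact (bdry A).
Proof.
move=> bA; apply: bounded_closed_compact.
  move: (bounded_closure _ bA) => [M [Mreal AM]]; exists M; split=> // N MN.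
  by move=> x [Ax _]; exact: AM.
by apply: closedI; [exact: closed_closure|exact/open_closedC/open_interior].
Qed.

(** Only small positive increments are controlled: differentiability makes the
    two-sided limit equal to the right one. *)
Lemma derive_le_slope {R : realType} {V : normedModType R} (g : V -> R)
    (x v : V) (r L : R) : derivable g x v -> 0 < r ->
  (forall t, 0 < t < r -> g (x + t *: v) <= g x + t * L) -> 'D_v g x <= L.
Proof.
move=> /cvg_dnbhs_at_right gxv r0 le_g; apply: (cvgr_to_le gxv).
near=> t; have t0 : 0 < t by near: t; exact: nbhs_right_gt.
have tr : t < r by near: t; exact: nbhs_right_lt.
rewrite -[_ *: _]/(t^-1 * _) -ler_pdivlMl ?invr_gt0// invrK lerBlDl /=.
by rewrite [_ *: _ + _]addrC; apply: le_g; exact/andP.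
Unshelve. all: by end_near. Qed.

Lemma derive_grad {R : realType} (g : 'rV[R]_2 -> R) (x v : 'rV[R]_2) :
  differentiable g x -> 'D_v g x = dot v (grad g x).
Proof.
move=> dg; rewrite deriveE// {1}(row_sum_delta v) linear_sum.
by apply: eq_bigr => i _; rewrite linearZ mxE deriveE.
Qed.


Lemma dist_bdry_le {R : realType} (Omega : set 'rV[R]_2) (x y : 'rV[R]_2) :
  bdry Omega y -> dist_bdry Omega x <= enorm (x - y).
Proof.
by move=> By; apply: ge_inf; [exists 0 => _ [z _ <-]; exact: enorm_ge0|exists y].
Qed.

(** The boundary is compact, so the infimum is a minimum. *)
Lemma dist_bdry_attained {R : realType} (Omega : set 'rV[R]_2) (x : 'rV[R]_2) :
  bounded_set Omega -> bdry Omega !=set0 ->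
  exists2 y, bdry Omega y & dist_bdry Omega x = enorm (x - y).
Proof.
move=> bO B0.
have [|y /set_mem By miny] :=
    @EVT_min_rV _ _ (fun y => enorm (x - y)) _ B0 (compact_bdry _ _ bO).
  apply: continuous_subspaceT => y.
  have cB : {for y, continuous (fun y : 'rV[R]_2 => x - y)}.
    exact: (cvgB (cvg_cst _) cvg_id).
  exact: (continuous_comp cB (continuous_enorm _)).
exists y => //; apply/eqP; rewrite eq_le dist_bdry_le//=.
apply: lb_le_inf; first by exists (enorm (x - y)), y.
by move=> _ [z Bz <-]; apply: miny; exact: mem_set.
Qed.

(** Moving from x towards a nearest boundary point y decreases the distance at
    unit rate, since y stays a competitor in the infimum. *)
Lemma enorm_grad_dist_ge1 {R : realType} (Omega : set 'rV[R]_2)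
    (x : 'rV[R]_2) : bounded_set Omega -> bdry Omega !=set0 ->
  ~ bdry Omega x -> differentiable (dist_bdry Omega) x ->
  1 <= enorm (grad (dist_bdry Omega) x).
Proof.
move=> bO B0 Bx dd; have [y By dxy] := dist_bdry_attained _ x bO B0.
have rho_gt0 : 0 < enorm (x - y).
  rewrite lt_neqAle enorm_ge0 andbT eq_sym enorm_eq0 subr_eq0.
  by apply: contra_notN Bx => /eqP ->.
set rho := enorm (x - y) in rho_gt0 dxy.
pose v := rho^-1 *: (y - x).
have v1 : enorm v = 1.
  by rewrite enormZ -opprB enormN gtr0_norm ?invr_gt0// mulVf ?gt_eqF.
have : 'D_v (dist_bdry Omega) x <= -1.
  apply: (derive_le_slope _ _ _ rho); [exact: diff_derivable|by []|].
  move=> t /andP[t0 trho]; apply: le_trans (dist_bdry_le _ _ y By) _.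
  have -> : x + t *: v - y = (1 - t / rho) *: (x - y).
    by apply/rowP => i; rewrite !mxE; ring.
  rewrite enormZ ger0_norm; last by rewrite subr_ge0 ler_pdivrMr// mul1r ltW.
  by rewrite -/rho dxy mulrN1 mulrBl mul1r divfK ?gt_eqF.
rewrite derive_grad// => le_dot.
have := Cauchy_Schwarz v (grad (dist_bdry Omega) x).
rewrite v1 mul1r; apply: le_trans; rewrite ler_normr; lra.
Qed.

Lemma enorm_outward_unit_normal {R : realType} (Omega : set 'rV[R]_2)
    (x nu : 'rV[R]_2) : outward_unit_normal Omega x nu -> enorm nu = 1.
Proof.
move=> [t [e [phi [[tt1 ee1 te0 _] ->]]]].
set a := derive1 phi 0.
have a0 : 0 < 1 + a ^+ 2 by rewrite ltr_wpDr// sqr_ge0.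
rewrite enormZ ger0_norm ?invr_ge0 ?sqrtr_ge0// /enorm.
have -> : dot (a *: t - e) (a *: t - e)
    = a ^+ 2 * dot t t - 2 * a * dot t e + dot e e.
  by rewrite !dotE !mxE; ring.
rewrite tt1 ee1 te0 mulr0 mulr1 subr0 [a ^+ 2 + 1]addrC.
by rewrite mulVf// gt_eqF// sqrtr_gt0.
Qed.

(** Gathers the boundary and the interior cases; a lower bound on the length of
    n is all that the growth estimates use. *)
Lemma enorm_normal_field_ge1 {R : realType} (Omega Gamma : set 'rV[R]_2)
    (n : 'rV[R]_2 -> 'rV[R]_2) (x : 'rV[R]_2) :
  open Omega -> bounded_set Omega -> bdry Omega !=set0 ->
  normal_field Omega Gamma n -> Gamma x -> closure Omega x -> 1 <= enorm (n x).
Proof.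
move=> oO bO B0 [n_bdry n_in] Gx Ox; have [Bx|Bx] := pselect (bdry Omega x).
  by rewrite (enorm_outward_unit_normal _ _ _ (n_bdry x Bx)).
have {}Ox : Omega x.
  apply: contrapT => nOx; apply: Bx; split=> //.
  by move/interior_id : oO => ->.
have [dd ->] := n_in x Gx Ox.
by rewrite enormN; exact: enorm_grad_dist_ge1.
Qed.

(** * Reflectance profiles as functions of sqrt (W + 1) *)

(** This is Young's inequality for the product of a and 1, with the exponent c
    and its conjugate c / (c - 1). *)
Lemma powR_Bernoulli {R : realType} (c a : R) :
  1 <= c -> 0 <= a -> 1 + c * (a - 1) <= a `^ c.
Proof.
rewrite le_eqVlt => /predU1P[<-|c1] a0.
  by rewrite powRr1//; lra.
have c0 : 0 < c by lra.
have q0 : 0 < c / (c - 1) by rewrite divr_gt0// subr_gt0.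
have pq : c^-1 + (c / (c - 1))^-1 = 1 by field; rewrite ?gt_eqF//; lra.
have := conjugate_powR a0 ler01 c0 q0 pq.
rewrite powR1 mulr1 invf_div mul1r -mulrDl ler_pdivlMr//; lra.
Qed.

(** The common form of the reflectance functions in the variable
    w = sqrt (W + 1).  The factor psi, not w psi, is isolated because the
    numerator of a difference of two profiles only sees the increments of
    psi. *)
Definition profile {R : realType} (psi : R -> R) (k l w : R) : R :=
  w / (k + l * (w * psi w)).

Definition admissible {R : realType} (psi : R -> R) (C : R) : Prop :=
  (forall w, 1 <= w -> 0 <= psi w) /\
  (forall v w, 1 <= v -> v <= w ->
    `|w * v * (psi v - psi w)| <= C * (w - v)).

(** The two fractions have denominators at least k, and their cross difference
    is k (w - v) + l w v (psi v - psi w). *)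
Lemma profile_lipschitz {R : realType} (psi : R -> R) (C k l v w : R) :
  admissible psi C -> 0 < k -> 0 <= l -> 1 <= v -> 1 <= w ->
  `|profile psi k l w - profile psi k l v| <= (k + l * C) / k ^+ 2 * `|w - v|.
Proof.
move=> [psi0 psiC] k0 l0.
wlog vw : v w / v <= w.
  move=> H v1 w1; have [|/ltW] := leP v w; first by move/H; apply.
  by move/H => {}H; rewrite distrC [in leRHS]distrC; exact: H.
move=> v1 w1.
have den_ge z : 1 <= z -> k <= k + l * (z * psi z).
  move=> z1; rewrite lerDl mulr_ge0// mulr_ge0 ?psi0//; lra.
set dv := k + l * (v * psi v); set dw := k + l * (w * psi w).
have kdv : k <= dv by exact: den_ge.
have kdw : k <= dw by exact: den_ge.
have dv0 : 0 < dv by exact: lt_le_trans kdv.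
have dw0 : 0 < dw by exact: lt_le_trans kdw.
have -> : profile psi k l w - profile psi k l v
    = (k * (w - v) + l * (w * v * (psi v - psi w))) / (dv * dw).
  rewrite /profile -/dv -/dw; apply: (mulIf (x := dv * dw)).
    by rewrite mulf_neq0 ?gt_eqF.
  rewrite divfK ?mulf_neq0 ?gt_eqF//.
  have -> : (w / dw - v / dv) * (dv * dw) =
      w / dw * dw * dv - v / dv * dv * dw by ring.
  by rewrite !divfK ?gt_eqF// /dv /dw; ring.
have dvw0 : 0 < dv * dw by exact: mulr_gt0.
rewrite normrM normfV (gtr0_norm dvw0).
rewrite [leRHS]mulrAC; apply: ler_pM => //.
- by rewrite invr_ge0 ltW.
- rewrite (ger0_norm (x := w - v)) ?subr_ge0// mulrDl -(mulrA l C).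
  apply: le_trans (ler_normD _ _) _.
  rewrite (normrM k) (normrM l).
  rewrite (gtr0_norm k0) (ger0_norm l0) (ger0_norm (x := w - v)) ?subr_ge0//.
  by rewrite lerD2l ler_wpM2l// psiC.
- rewrite lef_pV2 ?posrE ?exprn_gt0// expr2.
  by apply: ler_pM => //; exact: ltW.
Qed.

Lemma profile_ge {R : realType} (psi : R -> R) (k l w : R) :
  0 < k -> 0 <= l -> 1 <= w -> 0 <= w * psi w <= 1 ->
  w / (k + l) <= profile psi k l w.
Proof.
move=> k0 l0 w1 /andP[psi0 psi1]; rewrite /profile ler_wpM2l//; first lra.
have := mulr_ge0 l0 psi0; have := ler_wpM2l l0 psi1; rewrite mulr1 => ? ?.
by rewrite lef_pV2 ?posrE; lra.
Qed.

(** The middle term is (w - v) (1 / v + 1 / w). *)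
Lemma inv_sqr_gap {R : realType} (v w : R) : 1 <= v -> v <= w ->
  0 <= w * v * ((v ^+ 2)^-1 - (w ^+ 2)^-1) <= 2 * (w - v).
Proof.
move=> v1 vw; have v0 : 0 < v by lra.
have w0 : 0 < w by lra.
have -> : w * v * ((v ^+ 2)^-1 - (w ^+ 2)^-1) = (w - v) * (v^-1 + w^-1).
  by field; rewrite !gt_eqF.
have vV : v^-1 <= 1 by rewrite invf_le1.
have wV : w^-1 <= 1 by rewrite invf_le1//; lra.
have vV0 : 0 < v^-1 by rewrite invr_gt0.
have wV0 : 0 < w^-1 by rewrite invr_gt0.
rewrite mulr_ge0 ?subr_ge0//=; last by lra.
by rewrite mulrC ler_wpM2r ?subr_ge0//; lra.
Qed.

Lemma exprB_le {R : realType} (a b : R) (n : nat) : 0 <= b -> b <= a -> a <= 1 ->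
  0 <= a ^+ n - b ^+ n <= n%:R * (a - b).
Proof.
move=> b0 ba a1; have a0 : 0 <= a by lra.
rewrite subr_ge0 lerXn2r ?nnegrE//=.
elim: n => [|n IHn]; first by rewrite !expr0 subrr mul0r.
have -> : a ^+ n.+1 - b ^+ n.+1 = a * (a ^+ n - b ^+ n) + (a - b) * b ^+ n.
  by rewrite !exprS; ring.
rewrite -natr1 [leRHS]mulrDl mul1r lerD//.
  apply: le_trans IHn; rewrite ler_piMl// subr_ge0 lerXn2r ?nnegrE//.
by rewrite ler_piMr ?subr_ge0// exprn_ile1//; lra.
Qed.

Lemma admissible0 {R : realType} : admissible (fun=> 0 : R) 0.
Proof. by split=> // v w _ _; rewrite subrr mulr0 normr0 mul0r. Qed.

Definition psi_ON {R : realType} (w : R) : R := 1 - (w ^+ 2)^-1.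

Lemma admissible_ON {R : realType} : admissible (@psi_ON R) 2.
Proof.
split=> [w w1|v w v1 vw].
  by rewrite subr_ge0 invf_le1 ?exprn_ege1// exprn_gt0//; lra.
have /andP[gap0 gap] := inv_sqr_gap _ _ v1 vw.
rewrite (_ : psi_ON v - psi_ON w = - ((v ^+ 2)^-1 - (w ^+ 2)^-1)).
  by rewrite mulrN normrN ger0_norm.
by rewrite /psi_ON; ring.
Qed.

Definition psi_BP {R : realType} (c w : R) : R := w^-1 `^ c.

Lemma mul_psi_BP_le1 {R : realType} (c w : R) :
  1 <= c -> 1 <= w -> w * psi_BP c w <= 1.
Proof.
move=> c1 w1; have w0 : 0 < w by lra.
rewrite -ler_pdivlMl// mulr1 ge1r_powR//.
by rewrite invr_gt0 w0 invf_le1.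
Qed.

(** Factoring (1 / v) ^ c out of psi v - psi w leaves 1 - (v / w) ^ c, which
    Bernoulli's inequality bounds by c (1 - v / w). *)
Lemma admissible_BP {R : realType} (c : R) :
  1 <= c -> admissible (psi_BP c) c.
Proof.
move=> c1; split=> [w _|v w v1 vw]; first exact: powR_ge0.
have v0 : 0 < v by lra.
have w0 : 0 < w by lra.
have vw0 : 0 <= v / w by rewrite divr_ge0 ?ltW.
have vw1 : v / w <= 1 by rewrite ler_pdivrMr// mul1r.
have -> : psi_BP c w = psi_BP c v * (v / w) `^ c.
  rewrite /psi_BP -powRM ?invr_ge0 ?(ltW v0)//.
  by rewrite mulrA mulVf ?gt_eqF// mul1r.
have -> : w * v * (psi_BP c v - psi_BP c v * (v / w) `^ c) =
   (v * psi_BP c v) * (w * (1 - (v / w) `^ c)) by ring.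
have pow1 : (v / w) `^ c <= 1.
  apply: (@le_trans _ _ (1 `^ c)); last by rewrite powR1.
  by rewrite ge0_ler_powR ?nnegrE//; lra.
have psi0 : 0 <= v * psi_BP c v by rewrite mulr_ge0 ?powR_ge0// ltW.
have low0 : 0 <= w * (1 - (v / w) `^ c) by rewrite mulr_ge0 ?subr_ge0// ltW.
rewrite ger0_norm; last exact: mulr_ge0.
have lowE : w * (1 - (v / w) `^ c) <= c * (w - v).
  rewrite (_ : c * (w - v) = w * (c * (1 - v / w))).
    rewrite ler_pM2l//; have := powR_Bernoulli _ _ c1 vw0; lra.
  by field; rewrite gt_eqF.
by apply: le_trans lowE; rewrite ler_piMl// mul_psi_BP_le1.
Qed.

(** Since 1 - W = w ^ 2 (2 / w ^ 2 - 1), the base is (1 - W) / (1 + W) while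
    W < 1; its positive part absorbs the case distinction at W = 1. *)
Definition psi_PH {R : realType} (alpha : nat) (w : R) : R :=
  (Num.max 0 (2 / w ^+ 2 - 1)) ^+ alpha.

Lemma psi_PH_base {R : realType} (w : R) : 1 <= w ->
  0 <= Num.max 0 (2 / w ^+ 2 - 1) <= 1 /\
  w * Num.max 0 (2 / w ^+ 2 - 1) <= 1.
Proof.
move=> w1; have w0 : 0 < w by lra.
have w20 : 0 < w ^+ 2 by exact: exprn_gt0.
rewrite le_max lexx/= ge_max ler01/=; split.
  by rewrite lerBlDr ler_pdivrMr//; have := exprn_ege1 2 w1; lra.
case: (lerP 0 (2 / w ^+ 2 - 1)) => _; last by rewrite mulr0.
have -> : w * (2 / w ^+ 2 - 1) = 2 / w - w by field; rewrite gt_eqF.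
rewrite lerBlDr ler_pdivrMr//; nra.
Qed.

(** One factor of the power compensates w: w (2 / w ^ 2 - 1) = 2 / w - w is at
    most 1 for w >= 1. *)
Lemma mul_psi_PH_le1 {R : realType} (alpha : nat) (w : R) :
  (1 <= alpha)%N -> 1 <= w -> w * psi_PH alpha w <= 1.
Proof.
case: alpha => // alpha _ w1; have [/andP[m0 m1] wm] := psi_PH_base _ w1.
have w0 : 0 <= w by lra.
rewrite /psi_PH exprS mulrA mulr_ile1 ?mulr_ge0 ?exprn_ge0//.
exact: exprn_ile1.
Qed.

(** Powers of numbers in [0, 1] are Lipschitz with constant the exponent, which
    reduces the increments of psi to those of 2 / w ^ 2. *)
Lemma admissible_PH {R : realType} (alpha : nat) :
  admissible (@psi_PH R alpha) (alpha%:R * 4).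
Proof.
split=> [w w1|v w v1 vw].
  by have [/andP[m0 _] _] := psi_PH_base _ w1; exact: exprn_ge0.
have w1 : 1 <= w by lra.
have wv0 : 0 < w * v by rewrite mulr_gt0//; lra.
have /andP[gap0 gap] := inv_sqr_gap _ _ v1 vw.
have inv_vw : 2 / w ^+ 2 - 1 <= 2 / v ^+ 2 - 1.
  rewrite lerD2r ler_wpM2l// -subr_ge0.
  by rewrite -(pmulr_rge0 _ wv0).
have [/andP[_ mv1] _] := psi_PH_base _ v1.
have [/andP[mw0 _] _] := psi_PH_base _ w1.
have base_vw : Num.max 0 (2 / w ^+ 2 - 1) <= Num.max 0 (2 / v ^+ 2 - 1).
  by rewrite ge_max !le_max lexx inv_vw orbT.
have base_gap : Num.max 0 (2 / v ^+ 2 - 1) - Num.max 0 (2 / w ^+ 2 - 1)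
    <= 2 * ((v ^+ 2)^-1 - (w ^+ 2)^-1).
  case: (lerP 0 (2 / v ^+ 2 - 1)) => ?; case: (lerP 0 (2 / w ^+ 2 - 1)) => ?; lra.
have /andP[pow0 pow] := exprB_le _ _ alpha mw0 base_vw mv1.
rewrite /psi_PH ger0_norm; last by rewrite mulr_ge0// ltW.
have := ler_wpM2l (ltW wv0) pow.
have := ler_wpM2l (mulr_ge0 (ltW wv0) (ler0n R alpha)) base_gap.
have := ler_wpM2l (ler0n R alpha) gap.
set g := (v ^+ 2)^-1 - _; set m := Num.max _ _ - _.
move=> h1 h2 h3; apply: le_trans h3 _.
rewrite mulrA; apply: le_trans h2 _.
have -> : w * v * alpha%:R * (2 * g) = 2 * (alpha%:R * (w * v * g)) by ring.
lra.
Qed.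

(** * The four reflectance functions *)

Lemma F_L_profile {R : realType} (r : R) :
  F_L r = profile (fun=> 0) 1 0 (Num.sqrt (r + 1)).
Proof. by rewrite /F_L /profile mul0r addr0 divr1. Qed.

Lemma F_ON_profile {R : realType} (sigma r : R) : 0 <= r ->
  F_ON sigma r = profile psi_ON (ON_A sigma) (ON_B sigma) (Num.sqrt (r + 1)).
Proof.
move=> r0; rewrite /F_ON /profile /psi_ON; set w := Num.sqrt (r + 1).
have w0 : 0 < w by rewrite sqrtr_gt0; lra.
have -> : r = w ^+ 2 - 1 by rewrite sqr_sqrtr; lra.
rewrite subrK; set A := ON_A sigma; set B := ON_B sigma.
have -> : A + B * (w * (1 - (w ^+ 2)^-1)) = (A * w + B * (w ^+ 2 - 1)) / w.
  by field; rewrite gt_eqF.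
by rewrite invf_div mulrA expr2.
Qed.

Lemma F_BP_profile {R : realType} (kD kS c r : R) : 0 <= r ->
  F_BP kD kS c r = profile (psi_BP c) kD kS (Num.sqrt (r + 1)).
Proof.
move=> r0; rewrite /F_BP /profile /psi_BP; set w := Num.sqrt (r + 1).
have w0 : 0 < w by rewrite sqrtr_gt0; lra.
have powE a : (r + 1) `^ (a / 2) = w `^ a.
  rewrite (_ : r + 1 = w ^+ 2); last by rewrite sqr_sqrtr; lra.
  by rewrite -powR_mulrn ?ltW// -powRrM; congr (_ `^ _); field.
rewrite !powE -(powR_inv1 (ltW w0)) -powRrM mulN1r powRN.
rewrite powRB ?(gt_eqF w0) ?implybT// powRr1 ?ltW//.
have P0 : 0 < w `^ c by exact: powR_gt0.
set P := w `^ c in P0 *.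
have -> : kD + kS * (w * P^-1) = (w / P) * (kD * (P / w) + kS).
  by field; rewrite !gt_eqF.
by rewrite invfM invf_div !mulrA [w * P]mulrC mulfK ?gt_eqF.
Qed.

(** For W >= 1 the positive part vanishes and so does its power, the exponent
    being nonzero; the profile then reduces to w / kD. *)
Lemma F_PH_profile {R : realType} (kD kS : R) (alpha : nat) (r : R) :
  (1 <= alpha)%N -> 0 <= r ->
  F_PH kD kS alpha r = profile (psi_PH alpha) kD kS (Num.sqrt (r + 1)).
Proof.
move=> alpha1 r0; rewrite /F_PH /profile /psi_PH.
rewrite sqr_sqrtr ?addr_ge0//; set w := Num.sqrt (r + 1).
have r10 : 0 < r + 1 by lra.
have baseE : 2 / (r + 1) - 1 = (1 - r) / (r + 1) by field; rewrite gt_eqF.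
rewrite baseE; case: ifPn => [r1|].
  have /max_idPl -> : (1 - r) / (r + 1) <= 0.
    by rewrite ler_pdivrMr// mul0r; lra.
  by rewrite expr0n eqn0Ngt alpha1 !mulr0 addr0.
rewrite -ltNge => r1.
have /max_idPr -> : 0 <= (1 - r) / (r + 1) by rewrite divr_ge0; lra.
rewrite powRD ?(gt_eqF r10) ?implybT// powR_mulrn ?ltW//.
rewrite div1r powR12_sqrt ?ltW// -/w expr_div_n.
have P0 : 0 < (r + 1) ^+ alpha by exact: exprn_gt0.
set P := (r + 1) ^+ alpha in P0 *; set T := (1 - r) ^+ alpha.
have -> : kD * P + kS * w * T = P * (kD + kS * (w * (T / P))).
  by field; rewrite gt_eqF.
by rewrite invfM mulrACA divff ?gt_eqF// mul1r.
Qed.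

Lemma ON_A_gt0 {R : realType} (sigma : R) : 0 < ON_A sigma.
Proof.
have s0 := sqr_ge0 sigma.
rewrite /ON_A subr_gt0 ltr_pdivrMr; lra.
Qed.

Lemma ON_B_ge0 {R : realType} (sigma : R) : 0 <= ON_B sigma.
Proof.
have s0 := sqr_ge0 sigma.
by rewrite /ON_B divr_ge0//; lra.
Qed.

(** For Oren-Nayar, w psi w = w - 1 / w is unbounded, whence the restriction in
    the last clause. *)
Lemma Ffun_profile {R : realType} (sigma kD kS : R) (alpha : nat) (c : R)
    (M : model) : 0 < kD -> 0 <= kS -> (1 <= alpha)%N -> 1 <= c ->
  exists (psi : R -> R) (C k l : R),
    [/\ admissible psi C, 0 < k, 0 <= l,
        forall r, 0 <= r ->
          Ffun sigma kD kS alpha c M r = profile psi k l (Num.sqrt (r + 1)) &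
        M <> OrenNayar -> forall w, 1 <= w -> w * psi w <= 1].
Proof.
move=> kD0 kS0 alpha1 c1; case: M.
- exists (fun=> 0), 0, 1, 0; split=> //; first exact: admissible0.
  + by move=> r _; exact: F_L_profile.
  + by move=> _ w _; rewrite mulr0.
- exists psi_ON, 2, (ON_A sigma), (ON_B sigma); split=> //.
  + exact: admissible_ON.
  + exact: ON_A_gt0.
  + exact: ON_B_ge0.
  + by move=> r; exact: F_ON_profile.
- exists (psi_PH alpha), (alpha%:R * 4), kD, kS; split=> //.
  + exact: admissible_PH.
  + by move=> r; exact: F_PH_profile.
  + by move=> _ w; exact: mul_psi_PH_le1.
- exists (psi_BP c), c, kD, kS; split=> //.
  + exact: admissible_BP.
  + by move=> r; exact: F_BP_profile.
  + by move=> _ w; exact: mul_psi_BP_le1.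
Qed.

Lemma Ffun_lipschitz {R : realType} (sigma kD kS : R) (alpha : nat) (c : R)
    (M : model) : 0 < kD -> 0 <= kS -> (1 <= alpha)%N -> 1 <= c ->
  exists2 L : R, 0 <= L & forall r s, 0 <= r -> 0 <= s ->
    `|Ffun sigma kD kS alpha c M r - Ffun sigma kD kS alpha c M s|
      <= L * `|Num.sqrt (r + 1) - Num.sqrt (s + 1)|.
Proof.
move=> kD0 kS0 alpha1 c1.
have [psi [C [k [l [psiC k0 l0 FE _]]]]] :=
  Ffun_profile sigma kD kS alpha c M kD0 kS0 alpha1 c1.
have sqrt_ge1 (r : R) : 0 <= r -> 1 <= Num.sqrt (r + 1).
  by move=> r0; rewrite -[leLHS]sqrtr1 ler_wsqrtr// lerDr.
exists (Num.max 0 ((k + l * C) / k ^+ 2)); first by rewrite le_max lexx.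
move=> r s r0 s0; rewrite !FE//.
apply: le_trans (profile_lipschitz _ C _ _ _ _ psiC k0 l0 _ _) _.
- exact: sqrt_ge1.
- exact: sqrt_ge1.
- by rewrite ler_wpM2r// le_max lexx orbT.
Qed.

Lemma Ffun_growth {R : realType} (sigma kD kS : R) (alpha : nat) (c : R)
    (M : model) : 0 < kD -> 0 <= kS -> (1 <= alpha)%N -> 1 <= c ->
  M <> OrenNayar -> exists2 kappa : R, 0 < kappa & forall r, 0 <= r ->
    kappa * Num.sqrt r <= Ffun sigma kD kS alpha c M r.
Proof.
move=> kD0 kS0 alpha1 c1 MON.
have [psi [C [k [l [[psi0 _] k0 l0 FE psi1]]]]] :=
  Ffun_profile sigma kD kS alpha c M kD0 kS0 alpha1 c1.
exists (k + l)^-1; first by rewrite invr_gt0; lra.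
move=> r r0; rewrite FE//.
have w1 : 1 <= Num.sqrt (r + 1) by rewrite -[leLHS]sqrtr1 ler_wsqrtr// lerDr.
apply: le_trans (profile_ge psi _ _ _ k0 l0 w1 _).
  rewrite mulrC ler_wpM2r ?invr_ge0 ?ler_wsqrtr//; lra.
by rewrite psi1// mulr_ge0 ?psi0//; lra.
Qed.

(** * The quadratic form W *)

(** The difference of the squares is (a - a') (a + a') + (b - b') (b + b'), and
    |a + a'| and |b + b'| are at most the sum of the two roots. *)
Lemma ler_dist_sqrt_sqrD {R : realType} (a b a' b' : R) :
  `|Num.sqrt (a ^+ 2 + b ^+ 2 + 1) - Num.sqrt (a' ^+ 2 + b' ^+ 2 + 1)|
    <= `|a - a'| + `|b - b'|.
Proof.
set w := Num.sqrt _; set w' := Num.sqrt _.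
have sqr1 (x y : R) : 0 <= x ^+ 2 + y ^+ 2 + 1.
  by rewrite !addr_ge0 ?sqr_ge0.
have sum_gt0 : 0 < w + w'.
  rewrite addr_gt0// sqrtr_gt0 ltr_wpDl// addr_ge0 ?sqr_ge0//.
have le_w (x y : R) : `|x| <= Num.sqrt (x ^+ 2 + y ^+ 2 + 1).
  rewrite -sqrtr_sqr ler_wsqrtr// -addrA lerDl addr_ge0 ?sqr_ge0//.
have ww' : (w - w') * (w + w') = (a - a') * (a + a') + (b - b') * (b + b').
  rewrite -subr_sqr !sqr_sqrtr//; ring.
have le_sum (x x' : R) : `|x| <= w -> `|x'| <= w' ->
    `|(x - x') * (x + x')| <= `|x - x'| * (w + w').
  move=> xw xw'; rewrite normrM ler_wpM2l//.
  by apply: le_trans (ler_normD _ _) _; exact: lerD.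
rewrite -(ler_pM2r sum_gt0) -{1}(gtr0_norm sum_gt0) -normrM ww' [leRHS]mulrDl.
apply: le_trans (ler_normD _ _) _; apply: lerD; apply: le_sum.
- exact: le_w.
- exact: le_w.
- by rewrite /w [a ^+ 2 + _]addrC; exact: le_w.
- by rewrite /w' [a' ^+ 2 + _]addrC; exact: le_w.
Qed.

Lemma Qfun_gt0 {R : realType} (f : R) (x : 'rV[R]_2) : 0 < f -> 0 < Qfun f x.
Proof.
by move=> f0; rewrite divr_gt0// sqrtr_gt0 ltr_wpDr ?sqr_ge0// exprn_gt0.
Qed.

Lemma Qfun_le1 {R : realType} (f : R) (x : 'rV[R]_2) : 0 < f -> Qfun f x <= 1.
Proof.
move=> f0; rewrite /Qfun ler_pdivrMr ?mul1r; last first.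
  by rewrite sqrtr_gt0 ltr_wpDr ?sqr_ge0// exprn_gt0.
by rewrite -{1}(gtr0_norm f0) -sqrtr_sqr ler_wsqrtr// lerDl sqr_ge0.
Qed.

Lemma invr_Qfun_le {R : realType} (f : R) (x : 'rV[R]_2) : 0 < f ->
  (Qfun f x)^-1 <= (f + enorm x) / f.
Proof.
move=> f0; rewrite invf_div ler_pM2r ?invr_gt0//.
have s0 : 0 <= f + enorm x by rewrite addr_ge0 ?enorm_ge0 ?ltW.
rewrite -[leRHS](ger0_norm s0) -sqrtr_sqr ler_wsqrtr//.
have := mulr_ge0 (ltW f0) (enorm_ge0 x); nra.
Qed.

(** W is the squared length of the pair (f |p|, p . x) / Q, so that
    [ler_dist_sqrt_sqrD] applies to sqrt (W + 1). *)
Lemma WfunE {R : realType} (f : R) (x p : 'rV[R]_2) :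
  Wfun f x p = (f * enorm p / Qfun f x) ^+ 2 + (dot p x / Qfun f x) ^+ 2.
Proof. by rewrite /Wfun !expr_div_n exprMn mulrDl. Qed.

Lemma Wfun_ge0 {R : realType} (f : R) (x p : 'rV[R]_2) : 0 <= Wfun f x p.
Proof. by rewrite WfunE addr_ge0 ?sqr_ge0. Qed.

Lemma sqrt_Wfun_ge {R : realType} (f : R) (x p : 'rV[R]_2) : 0 < f ->
  f * enorm p <= Num.sqrt (Wfun f x p).
Proof.
move=> f0; have fp0 : 0 <= f * enorm p by rewrite mulr_ge0 ?enorm_ge0 ?ltW.
have Q0 := Qfun_gt0 f x f0; have Q1 := Qfun_le1 f x f0.
have fpQ : f * enorm p <= f * enorm p / Qfun f x.
  by rewrite ler_pdivlMr// ler_piMr.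
apply: le_trans fpQ _; apply: le_trans (ler_norm _) _.
by rewrite -sqrtr_sqr WfunE ler_wsqrtr// lerDl sqr_ge0.
Qed.

Lemma sqrt_Wfun_lipschitz {R : realType} (f X : R) (x p q : 'rV[R]_2) :
  0 < f -> enorm x <= X ->
  `|Num.sqrt (Wfun f x p + 1) - Num.sqrt (Wfun f x q + 1)|
    <= (f + X) ^+ 2 / f * enorm (p - q).
Proof.
move=> f0 xX; rewrite !WfunE; apply: le_trans (ler_dist_sqrt_sqrD _ _ _ _) _.
have Q0 := Qfun_gt0 f x f0; have x0 := enorm_ge0 x.
rewrite -!mulrBl -mulrBr.
have -> : dot p x - dot q x = dot (p - q) x by rewrite !dotE !mxE; ring.
rewrite !normrM normfV (gtr0_norm f0) (gtr0_norm Q0) -mulrDl.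
have num_le : f * `|enorm p - enorm q| + `|dot (p - q) x|
    <= (f + X) * enorm (p - q).
  rewrite mulrDl lerD ?ler_pM2l// ?ler_dist_enorm//.
  apply: le_trans (Cauchy_Schwarz _ _) _.
  by rewrite mulrC ler_wpM2r ?enorm_ge0.
have Q_le : (Qfun f x)^-1 <= (f + X) / f.
  by apply: le_trans (invr_Qfun_le f x f0) _; rewrite ler_pM2r ?invr_gt0 ?lerD2l.
have -> : (f + X) ^+ 2 / f * enorm (p - q)
    = (f + X) * enorm (p - q) * ((f + X) / f) by ring.
apply: ler_pM => //; last by rewrite invr_ge0 ltW.
by rewrite addr_ge0 ?mulr_ge0// ltW.
Qed.

(** * The Hamiltonians *)

Lemma near_pinfty_ex {R : realType} (P : R -> Prop) :
  (\forall t \near +oo, P t) -> exists t, P t.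
Proof. by move=> [t [_ tP]]; exists (t + 1); apply: tP; rewrite ltrDl. Qed.

Lemma lipschitz_bounded {R : realType} {V : normedModType R} (g : V -> R)
    (A : set V) : bounded_set A -> [lipschitz g x | x in A] ->
  exists2 M : R, 0 <= M & forall x, A x -> `|g x| <= M.
Proof.
move=> bA lipg.
have [N AN] := near_pinfty_ex _ bA; have [k gk] := near_pinfty_ex _ lipg.
have [[a Aa]|A0] := pselect (A !=set0); last first.
  by exists 0 => // x Ax; exfalso; apply: A0; exists x.
exists (`|g a| + `|k| * (N + `|a|)).
  by rewrite addr_ge0 ?mulr_ge0 ?addr_ge0// (le_trans _ (AN a Aa)).
move=> x Ax; rewrite -(subrK (g a) (g x)).
apply: le_trans (ler_normD _ _) _; rewrite addrC lerD2l.
apply: le_trans (gk (x, a) (conj Ax Aa)) _ => /=.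
apply: (@le_trans _ _ (`|k| * `|x - a|)); first by rewrite ler_wpM2r// ler_norm.
rewrite ler_wpM2l//; apply: le_trans (ler_normB _ _) _.
by rewrite lerD2r; exact: AN.
Qed.

(** The modulus is linear and independent of rho, because u enters H through an
    additive term only. *)
Lemma hamiltonian_H3 {R : realType} (f sigma kA kD kS : R) (alpha : nat)
    (c : R) (I IA : 'rV[R]_2 -> R) (M : model) (D : set 'rV[R]_2) :
  0 < f -> 0 < kD -> 0 <= kS -> (1 <= alpha)%N -> 1 <= c -> bounded_set D ->
  [lipschitz effective_intensity kA I IA M x | x in D] ->
  H3 D (hamiltonian f sigma kA kD kS alpha c I IA M).
Proof.
move=> f0 kD0 kS0 alpha1 c1 bD lipJ rho rho0.
have [MJ MJ0 JM] := lipschitz_bounded _ _ bD lipJ.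
have [X DX] := near_pinfty_ex _ bD.
have [L L0 FL] := Ffun_lipschitz sigma kD kS alpha c M kD0 kS0 alpha1 c1.
exists (fun t => MJ * f ^+ 2 * (L * ((f + 2 * X) ^+ 2 / f * t))); split.
  apply: cvg_at_right_filter.
  rewrite [X in _ --> X](_ : _ = MJ * f ^+ 2 * (L * ((f + 2 * X) ^+ 2 / f * 0)));
    last by rewrite !mulr0.
  by do 3! apply: cvgMr; exact: cvg_id.
move=> x u p q Dx _.
have -> : hamiltonian f sigma kA kD kS alpha c I IA M x u p
      - hamiltonian f sigma kA kD kS alpha c I IA M x u q
    = effective_intensity kA I IA M x * f ^+ 2
      * (Ffun sigma kD kS alpha c M (Wfun f x p)
         - Ffun sigma kD kS alpha c M (Wfun f x q)).
  by rewrite /hamiltonian; ring.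
rewrite 2!normrM (ger0_norm (x := f ^+ 2)) ?sqr_ge0//.
apply: ler_pM => //; first by rewrite mulr_ge0 ?sqr_ge0.
  by rewrite ler_wpM2r ?sqr_ge0 ?JM.
apply: le_trans (FL _ _ (Wfun_ge0 f x p) (Wfun_ge0 f x q)) _.
rewrite ler_wpM2l// sqrt_Wfun_lipschitz//.
by apply: le_trans (enorm_le_norm x) _; rewrite ler_wpM2l//; exact: DX.
Qed.

(** The linear growth in p of the Hamiltonian, from which both (H4) and (H5)
    follow. *)
Lemma hamiltonian_coercive {R : realType} (f sigma kA kD kS : R) (alpha : nat)
    (c : R) (I IA : 'rV[R]_2 -> R) (M : model) (delta : R) :
  0 < f -> 0 < kD -> 0 <= kS -> (1 <= alpha)%N -> 1 <= c ->
  M <> OrenNayar -> 0 < delta ->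
  exists2 K : R, 0 < K & forall x u p,
    delta <= effective_intensity kA I IA M x ->
    K * enorm p - expR (- 2 * u)
      <= hamiltonian f sigma kA kD kS alpha c I IA M x u p.
Proof.
move=> f0 kD0 kS0 alpha1 c1 MON delta0.
have [kappa kappa0 Fkappa] :=
  Ffun_growth sigma kD kS alpha c M kD0 kS0 alpha1 c1 MON.
exists (delta * f ^+ 2 * (kappa * f)).
  by rewrite !mulr_gt0// exprn_gt0.
move=> x u p deltaJ; rewrite addrC lerD2l -[leLHS]mulrA.
have f2 : 0 < f ^+ 2 by rewrite exprn_gt0.
apply: ler_pM.
- by rewrite ltW// mulr_gt0.
- by rewrite !mulr_ge0 ?enorm_ge0 ?ltW.
- by rewrite ler_pM2r.
- apply: le_trans (Fkappa _ (Wfun_ge0 f x p)).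
  by rewrite -mulrA ler_pM2l// sqrt_Wfun_ge.
Qed.

Lemma enorm_shift_ge {R : realType} (p nu : 'rV[R]_2) (lambda : R) :
  0 <= lambda -> 1 <= enorm nu -> lambda - enorm p <= enorm (p + lambda *: nu).
Proof.
move=> lambda0 nu1; rewrite lerBlDr.
apply: (@le_trans _ _ (enorm (lambda *: nu))).
  by rewrite enormZ ger0_norm// ler_peMr.
have := ler_enormD (p + lambda *: nu) (- p).
by rewrite enormN addrAC subrr add0r.
Qed.

Lemma coercive_H4 {R : realType} (D : set 'rV[R]_2) (n : 'rV[R]_2 -> 'rV[R]_2)
    (H : 'rV[R]_2 -> R -> 'rV[R]_2 -> R) (K : R) : 0 < K ->
  (forall x, D x -> 1 <= enorm (n x)) ->
  (forall x u p, D x -> K * enorm p - expR (- 2 * u) <= H x u p) ->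
  H4 D n H.
Proof.
move=> K0 n1 HK rho rho0; pose C := expR (2 * rho) / K.
have C0 : 0 < C by rewrite divr_gt0// expR_gt0.
exists (1 + C); first by lra.
move=> x u p lambda Dx /andP[u1 u2] Hle0.
have p0 := enorm_ge0 p.
have [lambda0|lambda0] := lerP lambda 0.
  by apply: le_trans lambda0 _; rewrite mulr_ge0; lra.
have q_ge := enorm_shift_ge p (n x) lambda (ltW lambda0) (n1 x Dx).
have q_le : enorm (p + lambda *: n x) <= C.
  rewrite ler_pdivlMr// mulrC; apply: (@le_trans _ _ (expR (- 2 * u))).
    by have := HK x u _ Dx; move/(_ (p + lambda *: n x)); lra.
  by rewrite ler_expR; lra.
have := mulr_ge0 (ltW C0) p0; lra.
Qed.

Lemma coercive_H5 {R : realType} (D : set 'rV[R]_2) (n : 'rV[R]_2 -> 'rV[R]_2)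
    (H : 'rV[R]_2 -> R -> 'rV[R]_2 -> R) (K : R) : 0 < K ->
  (forall x, D x -> 1 <= enorm (n x)) ->
  (forall x u p, D x -> K * enorm p - expR (- 2 * u) <= H x u p) ->
  H5 D n H.
Proof.
move=> K0 n1 HK R1 R2 R10 R20 N; near=> lambda.
have lambda0 : 0 <= lambda by near: lambda; exact: nbhs_pinfty_ge.
have lambda_ge : R2 + (N + expR (2 * R1)) / K <= lambda.
  by near: lambda; apply: nbhs_pinfty_ge; exact: num_real.
move=> x u p Dx /andP[u1 u2] pR2; apply: le_trans (HK x u _ Dx).
have q_ge := enorm_shift_ge p (- n x) lambda lambda0.
rewrite enormN scalerN in q_ge; have {}q_ge := q_ge (n1 x Dx).
have exp_le : expR (- 2 * u) <= expR (2 * R1) by rewrite ler_expR; lra.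
have : (N + expR (2 * R1)) / K <= enorm (p - lambda *: n x) by lra.
rewrite ler_pdivrMr//; lra.
Unshelve. all: by end_near. Qed.

Theorem proposition4p3 (R : realType) (Omega : set 'rV[R]_2)
    (f sigma kA kD kS : R) (alpha : nat) (c : R)
    (I IA : 'rV[R]_2 -> R) (n : 'rV[R]_2 -> 'rV[R]_2)
    (Omega_open : open Omega) (Omega_bounded : bounded_set Omega)
    (Omega_regular : W2infty_boundary Omega)
    (f_gt0 : 0 < f)
    (sigma_range : 0 <= sigma < pi / 2)
    (kA_ge0 : 0 <= kA) (kD_gt0 : 0 < kD) (kS_ge0 : 0 <= kS)
    (k_sum : kA + kD + kS = 1)
    (alpha_ge1 : (1 <= alpha)%N) (c_ge1 : 1 <= c) :
  let H := hamiltonian f sigma kA kD kS alpha c I IA in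
  let J := effective_intensity kA I IA in
  (forall (M : model) (Gamma : set 'rV[R]_2),
     M = Lambertian \/ M = Phong \/ M = BlinnPhong ->
     set_nbhs (bdry Omega) Gamma ->
     intensity_assumption Omega Gamma (J M) -> normal_field Omega Gamma n ->
     exists Gamma' : set 'rV[R]_2,
       [/\ set_nbhs (bdry Omega) Gamma', Gamma' `<=` Gamma,
           H3 (Gamma' `&` closure Omega) (H M),
           H4 (Gamma' `&` closure Omega) n (H M) &
           H5 (Gamma' `&` closure Omega) n (H M)]) /\
  (forall Gamma : set 'rV[R]_2,
     set_nbhs (bdry Omega) Gamma ->
     intensity_assumption Omega Gamma (J OrenNayar) ->
     normal_field Omega Gamma n ->
     exists Gamma' : set 'rV[R]_2,
       [/\ set_nbhs (bdry Omega) Gamma', Gamma' `<=` Gamma &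
           H3 (Gamma' `&` closure Omega) (H OrenNayar)]).
Proof.
move=> H J.
have bcl : bounded_set (closure Omega) by exact: bounded_closure.
have bD Gamma : bounded_set (Gamma `&` closure Omega).
  have [N [Nreal ON]] := bcl; exists N; split=> // t Nt x [_ Ox]; exact: ON Ox.
have lipD M Gamma : [lipschitz J M x | x in closure Omega] ->
    [lipschitz J M x | x in Gamma `&` closure Omega].
  by apply: sub_lipschitz => A clA [x y] [[_ Ox] [_ Oy]]; exact: clA.
have propH3 M Gamma : [lipschitz J M x | x in closure Omega] ->
    H3 (Gamma `&` closure Omega) (H M).
  by move=> lipJ; apply: hamiltonian_H3 => //; exact: lipD.
split=> [M Gamma M_cases nbhsG [lipJ [delta delta0 Jdelta]] nG|]; last first.
  move=> Gamma nbhsG [lipJ _] _; exists Gamma; split=> //; exact: propH3.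
have MON : M <> OrenNayar by case: M_cases => [|[]] ->.
(* A nearest boundary point exists only if the boundary is nonempty; otherwise
   every set, and in particular the empty one, is a neighborhood of it. *)
exists [set x | Gamma x /\ bdry Omega !=set0]; set Gamma' := [set x | _].
have [K K0 HK] := hamiltonian_coercive f sigma kA kD kS alpha c I IA M delta
  f_gt0 kD_gt0 kS_ge0 alpha_ge1 c_ge1 MON delta0.
have n1 x : (Gamma' `&` closure Omega) x -> 1 <= enorm (n x).
  by move=> [[Gx B0] Ox]; exact: (enorm_normal_field_ge1 Omega Gamma).
have HKD x u p : (Gamma' `&` closure Omega) x ->
    K * enorm p - expR (- 2 * u) <= H M x u p.
  by move=> [[Gx _] Ox]; apply: HK; exact: Jdelta.
split.
- by move=> x Bx; apply: filterS (nbhsG x Bx) => y Gy; split=> //; exists x.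
- by move=> x [].
- exact: propH3.
- exact: coercive_H4 K0 n1 HKD.
- exact: coercive_H5 K0 n1 HKD.
Qed.
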